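(* Consider the DF-SSQP algorithm described in the context and suppose (A1) holds. For each $k$ decompose $\tilde\Delta x_k=u_k+v_k$ with $u_k\in\mathrm{Null}(\tilde G_k)$ and $v_k\in\mathrm{Range}(\tilde G_k^T)$. Then there exist constants $\kappa_v,\kappa_u,\kappa_q>0$ such that for all $k\ge0$: (a) $\max\{\|v_k\|,\|v_k\|^2\}\le\kappa_v\|c_k\|$; (b) if $\|u_k\|^2\ge\kappa_u\|v_k\|^2$, then $\tilde\Delta x_k^T\tilde B_k\tilde\Delta x_k\ge0.5\,\kappa_{1,\tilde B}\|u_k\|^2$; (c) $\Delta q(\tilde\Delta x_k;\tau_k,x_k,\bar g_k,\tilde B_k)\ge\kappa_q\tau_k(\|\tilde\Delta x_k\|^2+\|c_k\|)$.
   Context: Problem and notation. Let $\mathcal P$ be a probability distribution on a sample space, $F(\cdot;\xi):\mathbb R^d\to\mathbb R$ for each sample $\xi$, $f(x)=\mathbb E_{\xi\sim\mathcal P}[F(x;\xi)]$, and $c:\mathbb R^d\to\mathbb R^m$. The problem is $\min_{x\in\mathbb R^d} f(x)$ subject to $c(x)=0$. Let $G(x)=\nabla c(x)\in\mathbb R^{m\times d}$ denote the constraint Jacobian, $c^j$ the $j$-th component of $c$, and $\mathcal L(x,\lambda)=f(x)+\lambda^Tc(x)$ the Lagrangian. A subscript $k$ denotes evaluation at the iterate $x_k$: $f_k=f(x_k)$, $\nabla f_k=\nabla f(x_k)$, $c_k=c(x_k)$, $G_k=G(x_k)$. For a vector $v$ with nonzero entries, $v^j$ is its $j$-th entry, $v^{-1}$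 is the entrywise reciprocal and $v^{-T}=(v^{-1})^T$. Norms are Euclidean norms for vectors and operator norms for matrices. Algorithm (DF-SSQP). Inputs: $(x_0,\lambda_0)\in\mathbb R^d\times\mathbb R^m$, $\bar g_{-1}\in\mathbb R^d$, $\bar G_{-1}\in\mathbb R^{m\times d}$, $\bar B_{-1}=I$, $\tau_{-1},\nu_{-1}>0$; positive sequences $\{b_k\},\{\tilde b_k\},\{\alpha_k\},\{\beta_k\}$; parameters $\sigma,\epsilon\in(0,1)$, $\psi\ge0$, $p\ge1$; positive constants $\kappa_{\nabla f},\kappa_{\nabla c}$ (Lipschitz constants of $\nabla f$ and $\nabla c$); a distribution $\mathcal P_\Delta$ on $\mathbb R^d$. For $k=0,1,2,\dots$: (1) Draw $\xi_k\sim\mathcal P$ and two independent directions $\Delta_k,\tilde\Delta_k\sim\mathcal P_\Delta$. (2) Gradient estimates: $\hat\nabla F(x_k;\xi_k)=\frac{F(x_k+b_k\Delta_k;\xi_k)-F(x_k-b_k\Delta_k;\xi_k)}{2b_k}\Delta_k^{-1}$ and $\hat\nabla c(x_k)=\frac{c(x_k+b_k\Delta_k)-c(x_k-b_k\Delta_k)}{2b_k}\Delta_k^{-T}\in\mathbb R^{m\times d}$; averages $\bar g_k=(1-\beta_k)\bar g_{k-1}+\beta_k\hat\nabla F(x_k;\xi_k)$, $\bar G_k=(1-\beta_k)\bar G_{k-1}+\beta_k\hat\nabla c(x_k)$. (3) Hessian estimates: for each sign $\pm$, $\tilde\nabla F(x_k\pm b_k\Delta_k;\xi_k)=\frac{F(x_k\pm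 b_k\Delta_k+\tilde b_k\tilde\Delta_k;\xi_k)-F(x_k\pm b_k\Delta_k;\xi_k)}{\tilde b_k}\tilde\Delta_k^{-1}$ and $\tilde\nabla c(x_k\pm b_k\Delta_k)=\frac{c(x_k\pm b_k\Delta_k+\tilde b_k\tilde\Delta_k)-c(x_k\pm b_k\Delta_k)}{\tilde b_k}\tilde\Delta_k^{-T}$; $\tilde\nabla c^j$ is the transpose of the $j$-th row of $\tilde\nabla c$; $\delta\tilde\nabla F_k=\tilde\nabla F(x_k+b_k\Delta_k;\xi_k)-\tilde\nabla F(x_k-b_k\Delta_k;\xi_k)$, $\delta\tilde\nabla c^j_k=\tilde\nabla c^j(x_k+b_k\Delta_k)-\tilde\nabla c^j(x_k-b_k\Delta_k)$; $\hat\nabla^2F(x_k;\xi_k)=\frac12\big[\frac{\delta\tilde\nabla F_k}{2b_k}\Delta_k^{-T}+\Delta_k^{-1}\frac{(\delta\tilde\nabla F_k)^T}{2b_k}\big]$ and $\hat\nabla^2c^j_k=\frac12\big[\frac{\delta\tilde\nabla c^j_k}{2b_k}\Delta_k^{-T}+\Delta_k^{-1}\frac{(\delta\tilde\nabla c^j_k)^T}{2b_k}\big]$, $1\le j\le m$. (4) $\tilde G_k=\bar G_k+\delta_k^G$ with $\delta_k^G$ a perturbation making $\tilde G_k$ of full row rank; $\bar\nabla_x\mathcal L_k=\bar g_k+\tilde G_k^T\lambda_k$; $\hat\nabla_x^2\mathcal L_k=\hat\nabla^2F(x_k;\xi_k)+\sum_{j=1}^m\lambda_k^j\hat\nabla^2c^j_k$;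 $\bar B_k=(1-\beta_k)\bar B_{k-1}+\beta_k\hat\nabla_x^2\mathcal L_k$; $\tilde B_k=\bar B_k+\delta_k^B$ with $\delta_k^B$ a perturbation making $\tilde B_k$ positive definite on $\ker\tilde G_k$. (5) Solve $\tilde W_k\binom{\tilde\Delta x_k}{\tilde\Delta\lambda_k}=-\binom{\bar\nabla_x\mathcal L_k}{c_k}$, where $\tilde W_k=\begin{pmatrix}\tilde B_k&\tilde G_k^T\\ \tilde G_k&0\end{pmatrix}$. (6) With $\Delta q(d;\tau,x_k,\bar g_k,\tilde B_k)=-\tau(\bar g_k^Td+\tfrac12\max\{d^T\tilde B_kd,0\})+\|c_k\|$: let $s_k=\bar g_k^T\tilde\Delta x_k+\max\{\tilde\Delta x_k^T\tilde B_k\tilde\Delta x_k,0\}$; $\tau_k^{trial}=\infty$ if $s_k\le0$, else $\tau_k^{trial}=(1-\sigma)\|c_k\|/s_k$; $\tau_k=\tau_{k-1}$ if $\tau_{k-1}\le\tau_k^{trial}$, else $\tau_k=(1-\epsilon)\tau_k^{trial}$. Let $\nu_k^{trial}=\Delta q(\tilde\Delta x_k;\tau_k,x_k,\bar g_k,\tilde B_k)/\|\tilde\Delta x_k\|^2$; $\nu_k=\nu_{k-1}$ if $\nu_{k-1}\le\nu_k^{trial}$, else $\nu_k=(1-\epsilon)\nu_k^{trial}$. (7) Pick any (random) stepsize $\bar\alpha_k$ with $\frac{\nu_k\alpha_k}{\tau_k\kappa_{\nabla f}+\kappa_{\nabla c}}\le\bar\alpha_k\le\frac{\nu_k\alpha_k}{\tau_k\kappa_{\nabla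 f}+\kappa_{\nabla c}}+\psi\alpha_k^p$, and set $(x_{k+1},\lambda_{k+1})=(x_k,\lambda_k)+\bar\alpha_k(\tilde\Delta x_k,\tilde\Delta\lambda_k)$. Assumption (A1): There is an open convex set $\mathcal X\subseteq\mathbb R^d$ containing all points $x_k$, $x_k\pm b_k\Delta_k$, $x_k\pm b_k\Delta_k+\tilde b_k\tilde\Delta_k$; $f$ and $c$ are thrice differentiable with bounded first, second and third derivatives on $\mathcal X$; $f$ is bounded below on $\mathcal X$; there are constants $\kappa_c,\kappa_{1,G},\kappa_{2,G},\kappa_{1,\tilde G},\kappa_{2,\tilde G}>0$ with $\|c_k\|\le\kappa_c$, $\kappa_{1,G}I\preceq G_kG_k^T\preceq\kappa_{2,G}I$, $\kappa_{1,\tilde G}I\preceq\tilde G_k\tilde G_k^T\preceq\kappa_{2,\tilde G}I$ for all $k\ge0$; and constants $\kappa_{1,\tilde B},\kappa_{2,\tilde B}>0$ with $x^T\tilde B_kx\ge\kappa_{1,\tilde B}\|x\|^2$ for all $x$ with $\tilde G_kx=0$ and $\|\tilde B_k\|\le\kappa_{2,\tilde B}$. *)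

(* Defs.v *)
From HB Require Import structures.
From mathcomp Require Import all_boot all_order all_algebra.
From mathcomp Require Import all_classical all_reals all_analysis.
Set Implicit Arguments. Unset Strict Implicit. Unset Printing Implicit Defensive.
Import Order.TTheory GRing.Theory Num.Theory.
Import numFieldNormedType.Exports.
Local Open Scope classical_set_scope.
Local Open Scope ring_scope.

Definition dotv (R : realType) (n : nat) (u v : 'cV[R]_n) : R := (u^T *m v) 0 0.
Definition enorm (R : realType) (n : nat) (v : 'cV[R]_n) : R := Num.sqrt (dotv v v).

Definition opnorm_le (R : realType) (m n : nat) (A : 'M[R]_(m, n)) (K : R) : Prop :=
  forall u : 'cV[R]_n, enorm (A *m u) <= K * enorm u.

Definition loewner_le (R : realType) (n : nat) (A B : 'M[R]_n) : Prop :=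
  forall w : 'cV[R]_n, dotv w (A *m w) <= dotv w (B *m w).

Definition quadf (R : realType) (n : nat) (B : 'M[R]_n) (v : 'cV[R]_n) : R := dotv v (B *m v).

Definition vinv (R : realType) (n : nat) (v : 'cV[R]_n) : 'cV[R]_n := map_mx (fun a => a^-1) v.

(** Constraint Jacobian G(x) = \nabla c(x) in R^{m x d}, from MathComp-Analysis' jacobian
    (which is stated for row vectors and gives the d x m matrix of the differential). *)
Definition cjac (R : realType) (d m : nat) (c : 'cV[R]_d -> 'cV[R]_m) (x : 'cV[R]_d)
  : 'M[R]_(m, d) := (jacobian (fun r : 'rV[R]_d => (c r^T)^T) x^T)^T.

(** Value at index k-1, with the initial value at k = 0 (index -1). *)
Definition prev (T : Type) (init : T) (s : nat -> T) (k : nat) : T :=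
  if k is k'.+1 then s k' else init.

Definition convex_setR (R : realType) (d : nat) (X : set 'cV[R]_d) : Prop :=
  forall a b : 'cV[R]_d, forall t : R, X a -> X b -> 0 <= t -> t <= 1 ->
    X ((1 - t) *: a + t *: b).

Definition Dq (R : realType) (d m : nat) (c : 'cV[R]_d -> 'cV[R]_m)
  (dd : 'cV[R]_d) (tau : R) (x : 'cV[R]_d) (g : 'cV[R]_d) (B : 'M[R]_d) : R :=
  - tau * (dotv g dd + 2^-1 * Num.max (quadf B dd) 0) + enorm (c x).

Section Estimators.
Variables (R : realType) (d m : nat) (Xi : Type).
Variables (F : Xi -> 'cV[R]_d -> R) (c : 'cV[R]_d -> 'cV[R]_m).

Definition gradF_hat (xi : Xi) (x : 'cV[R]_d) (b : R) (D : 'cV[R]_d) : 'cV[R]_d :=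
  ((F xi (x + b *: D) - F xi (x - b *: D)) / (2 * b)) *: vinv D.
Definition gradc_hat (x : 'cV[R]_d) (b : R) (D : 'cV[R]_d) : 'M[R]_(m, d) :=
  (2 * b)^-1 *: ((c (x + b *: D) - c (x - b *: D)) *m (vinv D)^T).

Definition gradF_tilde (xi : Xi) (y : 'cV[R]_d) (bt : R) (Dt : 'cV[R]_d) : 'cV[R]_d :=
  ((F xi (y + bt *: Dt) - F xi y) / bt) *: vinv Dt.
Definition gradc_tilde (y : 'cV[R]_d) (bt : R) (Dt : 'cV[R]_d) : 'M[R]_(m, d) :=
  bt^-1 *: ((c (y + bt *: Dt) - c y) *m (vinv Dt)^T).

Definition sym_hess (dv : 'cV[R]_d) (b : R) (D : 'cV[R]_d) : 'M[R]_d :=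
  2^-1 *: (((2 * b)^-1 *: dv) *m (vinv D)^T + vinv D *m ((2 * b)^-1 *: dv^T)).

Definition hessF_hat (xi : Xi) (x : 'cV[R]_d) (b bt : R) (D Dt : 'cV[R]_d) : 'M[R]_d :=
  sym_hess (gradF_tilde xi (x + b *: D) bt Dt - gradF_tilde xi (x - b *: D) bt Dt) b D.

Definition hessc_hat (j : 'I_m) (x : 'cV[R]_d) (b bt : R) (D Dt : 'cV[R]_d) : 'M[R]_d :=
  sym_hess ((row j (gradc_tilde (x + b *: D) bt Dt))^T
            - (row j (gradc_tilde (x - b *: D) bt Dt))^T) b D.

Definition hessL_hat (xi : Xi) (x : 'cV[R]_d) (lam : 'cV[R]_m) (b bt : R)
  (D Dt : 'cV[R]_d) : 'M[R]_d :=
  hessF_hat xi x b bt D Dt + \sum_(j < m) lam j 0 *: hessc_hat j x b bt D Dt.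
End Estimators.

(** A realization of the DF-SSQP algorithm: given the inputs and the realized
    samples xi_k and directions Delta_k, tDelta_k, the sequences
    x, lam, gbar, Gbar, Bbar, Gt (= tilde G), Bt (= tilde B), dx, dlam,
    tau, nu, abar satisfy steps (1)-(7). *)
Definition DFSSQP_run (R : realType) (d m : nat) (Xi : Type)
  (F : Xi -> 'cV[R]_d -> R) (c : 'cV[R]_d -> 'cV[R]_m)
  (x0 : 'cV[R]_d) (lam0 : 'cV[R]_m) (g_init : 'cV[R]_d) (G_init : 'M[R]_(m, d))
  (tau_init nu_init : R) (b bt alpha beta : nat -> R)
  (sigma eps psi p kf kc : R)
  (xi : nat -> Xi) (D Dt : nat -> 'cV[R]_d)
  (x : nat -> 'cV[R]_d) (lam : nat -> 'cV[R]_m)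
  (gbar : nat -> 'cV[R]_d) (Gbar : nat -> 'M[R]_(m, d)) (Bbar : nat -> 'M[R]_d)
  (Gt : nat -> 'M[R]_(m, d)) (Bt : nat -> 'M[R]_d)
  (dx : nat -> 'cV[R]_d) (dlam : nat -> 'cV[R]_m)
  (tau nu abar : nat -> R) : Prop :=
      ((0 < sigma < 1) /\ (0 < eps < 1) /\ 0 <= psi /\ 1 <= p /\ 0 < kf /\ 0 < kc) /\
      (0 < tau_init /\ 0 < nu_init) /\
      (forall k, [/\ 0 < b k, 0 < bt k, 0 < alpha k & 0 < beta k]) /\
      (x 0%N = x0 /\ lam 0%N = lam0) /\
      (* directions with nonzero entries (so that Delta^{-1} is defined) *)
      (forall k i, D k i 0 != 0 /\ Dt k i 0 != 0) /\
      (forall k, gbar k = (1 - beta k) *: prev g_init gbar k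
                          + beta k *: gradF_hat F (xi k) (x k) (b k) (D k)
              /\ Gbar k = (1 - beta k) *: prev G_init Gbar k
                          + beta k *: gradc_hat c (x k) (b k) (D k)) /\
      (forall k, Bbar k = (1 - beta k) *: prev 1%:M Bbar k
                          + beta k *: hessL_hat F c (xi k) (x k) (lam k) (b k) (bt k) (D k) (Dt k)) /\
      (forall k, row_free (Gt k)
              /\ (forall u : 'cV[R]_d, Gt k *m u = 0 -> u != 0 -> 0 < quadf (Bt k) u)) /\
      (forall k, block_mx (Bt k) (Gt k)^T (Gt k) 0 *m col_mx (dx k) (dlam k)
                 = - col_mx (gbar k + (Gt k)^T *m lam k) (c (x k))) /\
      (forall k, let s := dotv (gbar k) (dx k) + Num.max (quadf (Bt k) (dx k)) 0 in
                 let tprev := prev tau_init tau k in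
                 tau k = if s <= 0 then tprev
                         else let ttr := (1 - sigma) * enorm (c (x k)) / s in
                              if tprev <= ttr then tprev else (1 - eps) * ttr) /\
      (forall k, let ntr := Dq c (dx k) (tau k) (x k) (gbar k) (Bt k) / (enorm (dx k)) ^+ 2 in
                 let nprev := prev nu_init nu k in
                 nu k = if nprev <= ntr then nprev else (1 - eps) * ntr) /\
      (forall k, let a0 := nu k * alpha k / (tau k * kf + kc) in
                 [/\ a0 <= abar k, abar k <= a0 + psi * powR (alpha k) p,
                     x k.+1 = x k + abar k *: dx k &
                     lam k.+1 = lam k + abar k *: dlam k]).

(** The part of Assumption (A1) that is expressible for the data above. *)
Definition A1 (R : realType) (d m : nat) (c : 'cV[R]_d -> 'cV[R]_m)
  (b bt : nat -> R) (D Dt : nat -> 'cV[R]_d) (x : nat -> 'cV[R]_d)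
  (Gt : nat -> 'M[R]_(m, d)) (Bt : nat -> 'M[R]_d)
  (kap_c k1G k2G k1Gt k2Gt k1Bt k2Bt : R) : Prop :=
  (exists X : set 'cV[R]_d,
        [/\ open X, convex_setR X,
            (forall k, [/\ X (x k), X (x k + b k *: D k), X (x k - b k *: D k),
                           X (x k + b k *: D k + bt k *: Dt k)
                         & X (x k - b k *: D k + bt k *: Dt k)])
          & (forall y, X y -> differentiable c y)]) /\
      (0 < kap_c /\ 0 < k1G /\ 0 < k2G /\ 0 < k1Gt /\ 0 < k2Gt /\ 0 < k1Bt /\ 0 < k2Bt) /\
      (forall k, enorm (c (x k)) <= kap_c) /\
      (forall k, loewner_le (k1G%:M) (cjac c (x k) *m (cjac c (x k))^T)
                 /\ loewner_le (cjac c (x k) *m (cjac c (x k))^T) (k2G%:M)) /\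
      (forall k, loewner_le (k1Gt%:M) (Gt k *m (Gt k)^T)
                 /\ loewner_le (Gt k *m (Gt k)^T) (k2Gt%:M)) /\
      (forall k, (forall u : 'cV[R]_d, Gt k *m u = 0 -> k1Bt * (enorm u) ^+ 2 <= quadf (Bt k) u)
                 /\ opnorm_le (Bt k) k2Bt).

(* Main.v *)
(* The second block row of the KKT
   system says [G v = - c], and [G G^T >= k1 I] gives [k1 |v|^2 <= |G v|^2 = |c|^2]: the
   normal component is [O(|c|)], and so is [|v|^2] because [|c|] is bounded.  If the
   tangential component dominates, [|u|^2 >= kappa_u |v|^2], the curvature [k1B |u|^2] of
   [B] on the null space absorbs the cross terms [2 u^T B v + v^T B v], which are only
   [O(|u| |v| + |v|^2)] since [||B|| <= K].  The merit-parameter rule guarantees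
   [tau s <= (1 - sigma) |c|] whenever [s > 0], hence
   [Delta q >= sigma |c| + tau max(q, 0) / 2]; the curvature term controls
   [|dx|^2 = |u|^2 + |v|^2] in the tangential case, while in the normal case [|dx|^2] is
   itself [O(|c|)]. *)

Require Import Defs.
From HB Require Import structures.
From mathcomp Require Import all_boot all_order all_algebra.
From mathcomp Require Import all_classical all_reals all_analysis.
From mathcomp Require Import ring lra.

Set Implicit Arguments. Unset Strict Implicit. Unset Printing Implicit Defensive.
Import Order.TTheory GRing.Theory Num.Theory.
Local Open Scope ring_scope.

Section EuclideanGeometry.
Variables (R : realType) (n : nat).
Implicit Types (u v : 'cV[R]_n) (B : 'M[R]_n).

Lemma dotvE u v : dotv u v = \sum_i u i 0 * v i 0.
Proof. by rewrite /dotv !mxE; apply: eq_bigr => i _; rewrite mxE. Qed.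

Lemma dotvC u v : dotv u v = dotv v u.
Proof. by rewrite !dotvE; apply: eq_bigr => i _; rewrite mulrC. Qed.

Lemma dotvDr u v w : dotv u (v + w) = dotv u v + dotv u w.
Proof. by rewrite /dotv mulmxDr mxE. Qed.

Lemma dotvDl u v w : dotv (u + v) w = dotv u w + dotv v w.
Proof. by rewrite dotvC dotvDr !(dotvC w). Qed.

Lemma dotvZr a u v : dotv u (a *: v) = a * dotv u v.
Proof. by rewrite /dotv -scalemxAr mxE. Qed.

Lemma dotvZl a u v : dotv (a *: u) v = a * dotv u v.
Proof. by rewrite dotvC dotvZr dotvC. Qed.

Lemma dotvv_ge0 u : 0 <= dotv u u.
Proof. by rewrite dotvE; apply: sumr_ge0 => i _; rewrite -expr2 sqr_ge0. Qed.

Lemma dotvv_eq0 u : dotv u u = 0 -> u = 0.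
Proof.
rewrite dotvE => u0; apply/matrixP => i j; rewrite (ord1 j) mxE.
have uu_ge0 : forall k : 'I_n, true -> 0 <= u k 0 * u k 0.
  by move=> k _; rewrite -expr2 sqr_ge0.
by move: (psumr_eq0P uu_ge0 u0) => /(_ i isT)/eqP; rewrite mulf_eq0 orbb => /eqP.
Qed.

Lemma enorm_ge0 u : 0 <= enorm u.
Proof. exact: sqrtr_ge0. Qed.

Lemma enorm_sqr u : enorm u ^+ 2 = dotv u u.
Proof. by rewrite sqr_sqrtr ?dotvv_ge0. Qed.

Lemma enormN u : enorm (- u) = enorm u.
Proof. by rewrite /enorm -scaleN1r dotvZl dotvZr !mulN1r opprK. Qed.

Lemma enormD_sqr_orth u v :
  dotv u v = 0 -> enorm (u + v) ^+ 2 = enorm u ^+ 2 + enorm v ^+ 2.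
Proof.
by move=> uv0; rewrite !enorm_sqr dotvDl !dotvDr (dotvC v u) uv0 addr0 add0r.
Qed.

Lemma normr_dotv_le u v : `|dotv u v| <= enorm u * enorm v.
Proof.
set A := dotv u u; set B := dotv v v; set C := dotv u v.
have A_ge0 : 0 <= A := dotvv_ge0 u; have B_ge0 : 0 <= B := dotvv_ge0 v.
suff C2_le : C ^+ 2 <= A * B by rewrite -sqrtrM // -sqrtr_sqr ler_sqrt ?mulr_ge0.
have [B0 | B_neq0] := eqVneq B 0.
  by rewrite /C (dotvv_eq0 B0) dotvC dotvE big1 ?expr0n ?mulr_ge0 // => i _; rewrite mxE mul0r.
(* Expanding [0 <= |B u - C v|^2] gives [0 <= B (A B - C^2)]. *)
have : 0 <= B * (A * B - C ^+ 2).
  have := dotvv_ge0 (B *: u + (- C) *: v).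
  rewrite !dotvDl !dotvDr !dotvZl !dotvZr (dotvC v u) -/A -/B -/C.
  by congr (0 <= _); ring.
by rewrite pmulr_rge0 ?subr_ge0 // lt_def B_neq0.
Qed.

Lemma normr_dotv_opnorm_le B K u v :
  opnorm_le B K -> `|dotv u (B *m v)| <= K * (enorm u * enorm v).
Proof.
move=> BK; apply: le_trans (normr_dotv_le u (B *m v)) _.
by rewrite mulrCA ler_wpM2l ?enorm_ge0.
Qed.

Lemma quadfD B u v : quadf B (u + v) =
  quadf B u + dotv u (B *m v) + dotv v (B *m u) + quadf B v.
Proof. by rewrite /quadf mulmxDr dotvDl !dotvDr !addrA. Qed.

End EuclideanGeometry.

Lemma dotv_mulTmx (R : realType) (k n : nat) (A : 'M[R]_(k, n)) w v :
  dotv (A^T *m w) v = dotv w (A *m v).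
Proof. by rewrite /dotv trmx_mul trmxK mulmxA. Qed.

Section NullRangeDecomposition.
Variables (R : realType) (m n : nat) (G : 'M[R]_(m, n)).

Lemma dotv_null_range u w : G *m u = 0 -> dotv u (G^T *m w) = 0.
Proof. by move=> Gu0; rewrite dotvC dotv_mulTmx Gu0 /dotv mulmx0 mxE. Qed.

Lemma range_enorm_sqr_le (k1 : R) w : 0 < k1 -> loewner_le k1%:M (G *m G^T) ->
  k1 * enorm (G^T *m w) ^+ 2 <= enorm (G *m (G^T *m w)) ^+ 2.
Proof.
move=> k1_gt0 GG_ge; set v := G^T *m w; set r := G *m v.
have v_le : enorm v ^+ 2 <= enorm w * enorm r.
  by rewrite enorm_sqr dotv_mulTmx (ler_normlW (normr_dotv_le _ _)).
have w_le : k1 * enorm w ^+ 2 <= enorm v ^+ 2.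
  by have := GG_ge w; rewrite mul_scalar_mx dotvZr -mulmxA -dotv_mulTmx !enorm_sqr.
have w_ge0 := enorm_ge0 w; have r_ge0 := enorm_ge0 r.
have kw_le_r : k1 * enorm w <= enorm r.
  have [-> | w_neq0] := eqVneq (enorm w) 0; first by rewrite mulr0.
  rewrite -(ler_pM2r (_ : 0 < enorm w)) ?lt_def ?w_neq0 //.
  by rewrite -mulrA -expr2 (le_trans w_le) // mulrC.
(* [k1 |v|^2 <= k1 |w| |r| <= |r|^2] *)
nra.
Qed.

End NullRangeDecomposition.

(* Chosen so that, after AM-GM [2 K U V <= a U^2 / 4 + 4 K^2 V^2 / a], the cross terms
   cost at most [a U^2 / 2] (see [kappa_u_quad_ge]). *)
Definition kappa_u (R : realFieldType) (a K : R) : R := (16 * K ^+ 2 / a + 4 * K) / a + 1.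

Lemma kappa_u_gt0 (R : realFieldType) (a K : R) : 0 < a -> 0 <= K -> 0 < kappa_u a K.
Proof.
move=> a_gt0 K_ge0; have a_ge0 := ltW a_gt0; rewrite /kappa_u.
by apply: (ltr_wpDl _ ltr01); rewrite ?(divr_ge0, mulr_ge0, addr_ge0, sqr_ge0, ler0n).
Qed.

Lemma kappa_u_quad_ge (R : realFieldType) (a K U V : R) :
  0 < a -> 0 <= K -> 0 <= U -> 0 <= V -> kappa_u a K * V ^+ 2 <= U ^+ 2 ->
  2^-1 * a * U ^+ 2 <= a * U ^+ 2 - 2 * K * U * V - K * V ^+ 2.
Proof.
move=> a_gt0 K_ge0 U_ge0 V_ge0 UV_le; have a_neq0 : a != 0 := lt0r_neq0 a_gt0.
have am_gm : 2 * K * U * V <= a / 4 * U ^+ 2 + 4 * K ^+ 2 / a * V ^+ 2.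
  rewrite -subr_ge0.
  have -> : a / 4 * U ^+ 2 + 4 * K ^+ 2 / a * V ^+ 2 - 2 * K * U * V
          = a^-1 * (a / 2 * U - 2 * K * V) ^+ 2 by field.
  by rewrite mulr_ge0 ?sqr_ge0 ?invr_ge0 ?(ltW a_gt0).
have V_small : (4 * K ^+ 2 / a + K) * V ^+ 2 + a / 4 * V ^+ 2 <= a / 4 * U ^+ 2.
  have -> : (4 * K ^+ 2 / a + K) * V ^+ 2 + a / 4 * V ^+ 2
          = a / 4 * (kappa_u a K * V ^+ 2) by rewrite /kappa_u; field.
  by rewrite ler_pM2l ?divr_gt0.
have : 0 <= a / 4 * V ^+ 2 by rewrite mulr_ge0 ?sqr_ge0 ?divr_ge0 ?(ltW a_gt0).
nra.
Qed.

Lemma quadf_null_range_ge (R : realType) (n : nat) (B : 'M[R]_n) (k1 K : R) u v :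
  0 < k1 -> 0 <= K -> k1 * enorm u ^+ 2 <= quadf B u -> opnorm_le B K ->
  kappa_u k1 K * enorm v ^+ 2 <= enorm u ^+ 2 ->
  2^-1 * k1 * enorm u ^+ 2 <= quadf B (u + v).
Proof.
move=> k1_gt0 K_ge0 Bu_ge BK uv_le.
apply: le_trans (kappa_u_quad_ge k1_gt0 K_ge0 (enorm_ge0 u) (enorm_ge0 v) uv_le) _.
rewrite quadfD.
have := normr_dotv_opnorm_le u v BK; rewrite ler_norml => /andP[uv_ge _].
have := normr_dotv_opnorm_le v u BK; rewrite ler_norml => /andP[vu_ge _].
have := normr_dotv_opnorm_le v v BK; rewrite ler_norml => /andP[vv_ge _].
rewrite /quadf !expr2 in Bu_ge *; rewrite (mulrC (enorm v) (enorm u)) in vu_ge.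
lra.
Qed.

Section MeritParameter.
Variables (R : realFieldType) (sigma eps nc : R).
Hypotheses (sigma_le1 : sigma <= 1) (eps_ge0 : 0 <= eps) (eps_le1 : eps <= 1) (nc_ge0 : 0 <= nc).

Definition merit_update (s tprev : R) : R :=
  if s <= 0 then tprev
  else let ttr := (1 - sigma) * nc / s in
       if tprev <= ttr then tprev else (1 - eps) * ttr.

Let trial_ge0 s : 0 < s -> 0 <= (1 - sigma) * nc / s.
Proof. by move=> s_gt0; rewrite divr_ge0 ?mulr_ge0 ?subr_ge0 ?(ltW s_gt0). Qed.

Lemma merit_update_ge0 s tprev : 0 <= tprev -> 0 <= merit_update s tprev.
Proof.
rewrite /merit_update => tprev_ge0; case: (leP s 0) => //= s_gt0.
by case: ifP => // _; rewrite mulr_ge0 ?subr_ge0 ?trial_ge0.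
Qed.

Lemma merit_update_le s tprev : merit_update s tprev <= tprev.
Proof.
rewrite /merit_update; case: (leP s 0) => //= s_gt0.
case: (leP tprev ((1 - sigma) * nc / s)) => // /ltW; apply: le_trans.
by rewrite ler_piMl ?trial_ge0 // gerBl.
Qed.

Lemma merit_update_mul_le s tprev :
  0 < s -> merit_update s tprev * s <= (1 - sigma) * nc.
Proof.
rewrite /merit_update => s_gt0; rewrite (leNgt s) s_gt0 /=.
have trial_mul : (1 - sigma) * nc / s * s = (1 - sigma) * nc by rewrite divfK ?gt_eqF.
case: (leP tprev ((1 - sigma) * nc / s)) => [tprev_le | _].
  by rewrite -trial_mul ler_wpM2r ?(ltW s_gt0).
by rewrite -[leRHS]trial_mul ler_wpM2r ?(ltW s_gt0) // ler_piMl ?trial_ge0 // gerBl.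
Qed.

End MeritParameter.

Lemma prev_bounded_nonincreasing (R : realFieldType) (t0 : R) (t : nat -> R) :
  0 <= t0 -> (forall k, 0 <= Defs.prev t0 t k -> 0 <= t k <= Defs.prev t0 t k) ->
  forall k, 0 <= t k <= t0.
Proof.
move=> t0_ge0 step; elim=> [|k /andP[tk_ge0 tk_le]]; first exact: step.
by have /andP[-> /le_trans ->] := step k.+1 tk_ge0.
Qed.

Lemma Dq_ge (R : realType) (d m : nat) (c : 'cV[R]_d -> 'cV[R]_m) (dx x g : 'cV[R]_d)
    (B : 'M[R]_d) (tau sigma : R) :
  0 <= tau -> sigma <= 1 ->
  (0 < dotv g dx + Num.max (quadf B dx) 0 ->
     tau * (dotv g dx + Num.max (quadf B dx) 0) <= (1 - sigma) * enorm (c x)) ->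
  sigma * enorm (c x) + tau * (2^-1 * Num.max (quadf B dx) 0) <= Dq c dx tau x g B.
Proof.
move=> tau_ge0 sigma_le1; rewrite /Dq; set M := Num.max _ _; set s := _ + M.
have M_ge0 : 0 <= M by rewrite le_max lexx orbT.
have c_ge0 := enorm_ge0 (c x).
have -> : - tau * (dotv g dx + 2^-1 * M) = - (tau * s) + tau * (2^-1 * M) by rewrite /s; field.
case: (ltP 0 s) => [s_gt0 /(_ isT) | s_le0 _]; first by lra.
have : tau * s <= 0 by rewrite mulr_ge0_le0.
have : 0 <= (1 - sigma) * enorm (c x) by rewrite mulr_ge0 ?subr_ge0.
lra.
Qed.

Section Constants.
Variables (R : realType) (k1G kap k1B K sigma tau0 : R).

Definition kappa_v : R := Num.sqrt k1G^-1 + kap / k1G.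

Definition kappa_q : R :=
  Num.min (k1B / (4 * (1 + (kappa_u k1B K)^-1)))
    (Num.min (sigma / tau0) (sigma / (tau0 * ((kappa_u k1B K + 1) * kappa_v + 1)))).

Hypotheses (k1G_gt0 : 0 < k1G) (kap_ge0 : 0 <= kap) (k1B_gt0 : 0 < k1B) (K_ge0 : 0 <= K)
  (sigma_gt0 : 0 < sigma) (tau0_gt0 : 0 < tau0).

Lemma kappa_v_gt0 : 0 < kappa_v.
Proof. by rewrite ltr_wpDr ?divr_ge0 ?sqrtr_gt0 ?invr_gt0 ?(ltW k1G_gt0). Qed.

Lemma kappa_q_gt0 : 0 < kappa_q.
Proof.
rewrite /kappa_q; have := kappa_v_gt0; have := kappa_u_gt0 k1B_gt0 K_ge0.
move: (kappa_u k1B K) kappa_v => ku kv ku_gt0 kv_gt0.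
by rewrite !lt_min ?(divr_gt0, mulr_gt0, addr_gt0, invr_gt0, ltr01, ltr0n).
Qed.

Lemma kappa_q_le_tangential : kappa_q * (4 * (1 + (kappa_u k1B K)^-1)) <= k1B.
Proof.
rewrite -ler_pdivlMr ?mulr_gt0 ?ltr0n ?addr_gt0 ?invr_gt0 ?kappa_u_gt0 //.
by rewrite /kappa_q ge_min lexx.
Qed.

Lemma kappa_q_le_merit : kappa_q * tau0 <= sigma.
Proof. by rewrite -ler_pdivlMr // /kappa_q !ge_min lexx /= orbT. Qed.

Lemma kappa_q_le_normal : kappa_q * (tau0 * ((kappa_u k1B K + 1) * kappa_v + 1)) <= sigma.
Proof.
have ku_gt0 := kappa_u_gt0 k1B_gt0 K_ge0; have kv_gt0 := kappa_v_gt0.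
have P_gt0 : 0 < tau0 * ((kappa_u k1B K + 1) * kappa_v + 1).
  by rewrite mulr_gt0 // addr_gt0 // mulr_gt0 // addr_gt0.
rewrite -ler_pdivlMr //.
by rewrite /kappa_q !ge_min lexx /= !orbT.
Qed.

End Constants.

Lemma model_reduction_estimate (R : realFieldType) (kq tau tau0 sigma k1 ku kv U V nc M : R) :
  0 < ku -> 0 < kv -> 0 <= kq -> 0 <= tau -> tau <= tau0 ->
  0 <= U -> 0 <= V -> 0 <= nc -> 0 <= M ->
  kq * (4 * (1 + ku^-1)) <= k1 -> kq * tau0 <= sigma ->
  kq * (tau0 * ((ku + 1) * kv + 1)) <= sigma ->
  V <= kv * nc -> (ku * V <= U -> 2^-1 * k1 * U <= M) ->
  kq * tau * (U + V + nc) <= sigma * nc + tau * (2^-1 * M).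
Proof.
move=> ku_gt0 kv_gt0 kq_ge0 tau_ge0 tau_le U_ge0 V_ge0 nc_ge0 M_ge0.
move=> tangential_le merit_le normal_le V_le M_ge.
have kq_tau := le_trans (ler_wpM2l kq_ge0 tau_le) merit_le.
have tau_nc := ler_wpM2r nc_ge0 kq_tau.
case: (leP (ku * V) U) => [tangential | /ltW normal].
- have V_le_U : V <= ku^-1 * U by rewrite ler_pdivlMl.
  have kq_UV : kq * (U + V) <= 2^-1 * M.
    have := ler_wpM2l kq_ge0 V_le_U; have := ler_wpM2r U_ge0 tangential_le.
    have := M_ge tangential; lra.
  have := ler_wpM2l tau_ge0 kq_UV; lra.
- have ku1_gt0 : 0 < ku + 1 := ltr_wpDr ler01 ku_gt0.
  have sum_le : U + V + nc <= ((ku + 1) * kv + 1) * nc.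
    have := ler_wpM2l (ltW ku1_gt0) V_le; nra.
  have Pnc_ge0 : 0 <= ((ku + 1) * kv + 1) * nc.
    by apply: mulr_ge0 => //; have := mulr_gt0 ku1_gt0 kv_gt0; lra.
  have := ler_wpM2l (mulr_ge0 kq_ge0 tau_ge0) sum_le.
  have := ler_wpM2r Pnc_ge0 (ler_wpM2l kq_ge0 tau_le).
  have := ler_wpM2r nc_ge0 normal_le.
  have : 0 <= tau * (2^-1 * M) by rewrite mulr_ge0 ?mulr_ge0 ?invr_ge0.
  nra.
Qed.

Lemma kkt_constraint_rows (R : ringType) (n m : nat) (B : 'M[R]_n) (G : 'M[R]_(m, n))
    dx (dl : 'cV[R]_m) r cx :
  block_mx B G^T G 0 *m col_mx dx dl = - col_mx r cx -> G *m dx = - cx.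
Proof. by rewrite mul_block_col opp_col_mx mul0mx addr0 => /eq_col_mx[]. Qed.

Section Iteration.
Variables (R : realType) (d m : nat) (c : 'cV[R]_d -> 'cV[R]_m).
Variables (x g dx u v : 'cV[R]_d) (w : 'cV[R]_m) (G : 'M[R]_(m, d)) (B : 'M[R]_d).
Variables (tau tau0 sigma k1G kap k1B K : R).
Hypotheses (dx_split : dx = u + v) (Gu0 : G *m u = 0) (v_range : v = G^T *m w).
Hypotheses (Gdx : G *m dx = - c x) (k1G_gt0 : 0 < k1G) (GG_ge : loewner_le k1G%:M (G *m G^T))
  (c_le : enorm (c x) <= kap).
Hypotheses (k1B_gt0 : 0 < k1B) (K_ge0 : 0 <= K) (BK : opnorm_le B K)
  (B_null : forall z, G *m z = 0 -> k1B * enorm z ^+ 2 <= quadf B z).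

Lemma normal_step_sqr_le : k1G * enorm v ^+ 2 <= enorm (c x) ^+ 2.
Proof.
have Gv : G *m v = - c x by rewrite -Gdx dx_split mulmxDr Gu0 add0r.
by rewrite -(enormN (c x)) -Gv v_range range_enorm_sqr_le.
Qed.

Lemma normal_step_bound : Num.max (enorm v) (enorm v ^+ 2) <= kappa_v k1G kap * enorm (c x).
Proof.
have c_ge0 := enorm_ge0 (c x); have ik_ge0 : 0 <= k1G^-1 by rewrite invr_ge0 ltW.
have v_sqr_le : enorm v ^+ 2 <= k1G^-1 * enorm (c x) ^+ 2.
  by rewrite -(ler_pM2l k1G_gt0) mulVKf ?gt_eqF // normal_step_sqr_le.
rewrite ge_max; apply/andP; split.
- have -> : enorm v = Num.sqrt (enorm v ^+ 2) by rewrite sqrtr_sqr ger0_norm ?enorm_ge0.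
  apply: le_trans (_ : Num.sqrt k1G^-1 * enorm (c x) <= _).
    by rewrite -[enorm (c x)]ger0_norm // -sqrtr_sqr -sqrtrM // ler_sqrt ?mulr_ge0 ?sqr_ge0.
  by rewrite ler_wpM2r // lerDl divr_ge0 ?(ltW k1G_gt0) // (le_trans c_ge0).
- apply: le_trans v_sqr_le _; rewrite expr2 mulrA ler_wpM2r //.
  apply: le_trans (_ : k1G^-1 * kap <= _); first by rewrite ler_wpM2l.
  by rewrite mulrC lerDr sqrtr_ge0.
Qed.

Lemma tangential_curvature :
  kappa_u k1B K * enorm v ^+ 2 <= enorm u ^+ 2 -> 2^-1 * k1B * enorm u ^+ 2 <= quadf B dx.
Proof. by rewrite dx_split; apply: quadf_null_range_ge; rewrite ?B_null. Qed.

Hypotheses (sigma_gt0 : 0 < sigma) (sigma_le1 : sigma <= 1) (tau0_gt0 : 0 < tau0)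
  (tau_ge0 : 0 <= tau) (tau_le : tau <= tau0)
  (tau_decrease : 0 < dotv g dx + Num.max (quadf B dx) 0 ->
     tau * (dotv g dx + Num.max (quadf B dx) 0) <= (1 - sigma) * enorm (c x)).

Lemma model_reduction_bound :
  kappa_q k1G kap k1B K sigma tau0 * tau * (enorm dx ^+ 2 + enorm (c x))
    <= Dq c dx tau x g B.
Proof.
apply: le_trans (Dq_ge tau_ge0 sigma_le1 tau_decrease).
have kap_ge0 : 0 <= kap := le_trans (enorm_ge0 _) c_le.
have -> : enorm dx ^+ 2 = enorm u ^+ 2 + enorm v ^+ 2.
  by rewrite dx_split enormD_sqr_orth // v_range dotv_null_range.
have := normal_step_bound; rewrite ge_max => /andP[_ v_sqr_le].
have M_ge0 : 0 <= Num.max (quadf B dx) 0 by rewrite le_max lexx orbT.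
have M_ge : kappa_u k1B K * enorm v ^+ 2 <= enorm u ^+ 2 ->
    2^-1 * k1B * enorm u ^+ 2 <= Num.max (quadf B dx) 0.
  by move=> /tangential_curvature q_ge; rewrite le_max q_ge.
exact: (model_reduction_estimate (kappa_u_gt0 k1B_gt0 K_ge0) (kappa_v_gt0 k1G_gt0 kap_ge0)
  (ltW (kappa_q_gt0 k1G_gt0 kap_ge0 k1B_gt0 K_ge0 sigma_gt0 tau0_gt0)) tau_ge0 tau_le
  (sqr_ge0 _) (sqr_ge0 _) (enorm_ge0 _) M_ge0
  (kappa_q_le_tangential k1G kap sigma tau0 k1B_gt0 K_ge0)
  (kappa_q_le_merit k1G kap k1B K sigma tau0_gt0)
  (kappa_q_le_normal sigma k1G_gt0 kap_ge0 k1B_gt0 K_ge0 tau0_gt0) v_sqr_le M_ge).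
Qed.

End Iteration.

Theorem lemma3p8 (R : realType) (d m : nat) (Xi : Type)
  (F : Xi -> 'cV[R]_d -> R) (c : 'cV[R]_d -> 'cV[R]_m)
  (x0 : 'cV[R]_d) (lam0 : 'cV[R]_m) (g_init : 'cV[R]_d) (G_init : 'M[R]_(m, d))
  (tau_init nu_init : R) (b bt alpha beta : nat -> R)
  (sigma eps psi p kf kc : R)
  (xi : nat -> Xi) (D Dt : nat -> 'cV[R]_d)
  (x : nat -> 'cV[R]_d) (lam : nat -> 'cV[R]_m)
  (gbar : nat -> 'cV[R]_d) (Gbar : nat -> 'M[R]_(m, d)) (Bbar : nat -> 'M[R]_d)
  (Gt : nat -> 'M[R]_(m, d)) (Bt : nat -> 'M[R]_d)
  (dx : nat -> 'cV[R]_d) (dlam : nat -> 'cV[R]_m)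
  (tau nu abar : nat -> R)
  (kap_c k1G k2G k1Gt k2Gt k1Bt k2Bt : R) :
  DFSSQP_run F c x0 lam0 g_init G_init tau_init nu_init b bt alpha beta
    sigma eps psi p kf kc xi D Dt x lam gbar Gbar Bbar Gt Bt dx dlam tau nu abar ->
  A1 c b bt D Dt x Gt Bt kap_c k1G k2G k1Gt k2Gt k1Bt k2Bt ->
  exists kv ku kq : R, [/\ 0 < kv, 0 < ku, 0 < kq &
    forall (k : nat) (u v : 'cV[R]_d),
      dx k = u + v -> Gt k *m u = 0 -> (exists w : 'cV[R]_m, v = (Gt k)^T *m w) ->
      [/\ Num.max (enorm v) (enorm v ^+ 2) <= kv * enorm (c (x k)),
          (ku * enorm v ^+ 2 <= enorm u ^+ 2 ->
             2^-1 * k1Bt * enorm u ^+ 2 <= quadf (Bt k) (dx k)) &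
          kq * tau k * (enorm (dx k) ^+ 2 + enorm (c (x k)))
            <= Dq c (dx k) (tau k) (x k) (gbar k) (Bt k)]].
Proof.
move=> run hA1.
case: run => [[/andP[sigma_gt0 sigma_lt1] [/andP[eps_gt0 eps_lt1] _]] [[tau0_gt0 _] run]].
case: run => [_ [_ [_ [_ [_ [_ [kkt [tau_def _]]]]]]]].
case: hA1 => [_ [[kap_gt0 [_ [_ [k1Gt_gt0 [_ [k1B_gt0 K_gt0]]]]]] [c_le [_ [GG_ge B_hyp]]]]].
have [sigma_le1 eps_ge0 eps_le1] := And3 (ltW sigma_lt1) (ltW eps_gt0) (ltW eps_lt1).
have [kap_ge0 K_ge0] := (ltW kap_gt0, ltW K_gt0).
have tau_upd k : tau k = merit_update sigma eps (enorm (c (x k)))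
    (dotv (gbar k) (dx k) + Num.max (quadf (Bt k) (dx k)) 0) (Defs.prev tau_init tau k).
  exact: tau_def.
have tau_bounds : forall k, 0 <= tau k <= tau_init.
  apply: prev_bounded_nonincreasing (ltW tau0_gt0) _ => k tprev_ge0.
  by rewrite tau_upd merit_update_ge0 ?merit_update_le ?enorm_ge0.
exists (kappa_v k1Gt kap_c), (kappa_u k1Bt k2Bt), (kappa_q k1Gt kap_c k1Bt k2Bt sigma tau_init).
split=> [|||k u v dx_split Gu0 [w v_range]].
- exact: kappa_v_gt0.
- exact: kappa_u_gt0.
- exact: kappa_q_gt0.
have Gdx := kkt_constraint_rows (kkt k).
have /andP[tau_ge0 tau_le] := tau_bounds k.
have tau_decrease : 0 < dotv (gbar k) (dx k) + Num.max (quadf (Bt k) (dx k)) 0 ->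
    tau k * (dotv (gbar k) (dx k) + Num.max (quadf (Bt k) (dx k)) 0)
      <= (1 - sigma) * enorm (c (x k)).
  by rewrite tau_upd; apply: merit_update_mul_le; rewrite ?enorm_ge0.
have [B_null BK] := B_hyp k.
split.
- exact: normal_step_bound dx_split Gu0 v_range Gdx k1Gt_gt0 (GG_ge k).1 (c_le k).
- exact: tangential_curvature dx_split Gu0 k1B_gt0 K_ge0 BK B_null.
- exact: model_reduction_bound dx_split Gu0 v_range Gdx k1Gt_gt0 (GG_ge k).1 (c_le k)
    k1B_gt0 K_ge0 BK B_null sigma_gt0 sigma_le1 tau0_gt0 tau_ge0 tau_le tau_decrease.
Qed.
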